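(* Let $d\ge 2$ and let $T$ be a $d$-simplex in a Minkowski space $(\mathbb{R}^d,\|\cdot\|)$ with a circumcenter $M$ distinct from its centroid $G$. Let $P_M$ be the complementary point and $N_M$ the Monge point of $T$ associated to $M$. Then: (a) $P_M$ and $N_M$ lie on the Euler line $\langle MG\rangle$. (b) $G$ divides the segment $[MP_M]$ internally in the ratio $1:d$. (c) $N_M$ divides the segment $[MP_M]$ internally in the ratio $1:(d-2)$. (d) $G$ divides the segment $[MN_M]$ internally in the ratio $(d-1):2$.
   Context: A Minkowski space $(\mathbb{R}^d,\|\cdot\|)$ is $\mathbb{R}^d$ with an arbitrary norm. A $d$-simplex is the convex hull $T=\mathrm{conv}\{A_0,\ldots,A_d\}$ of $d+1$ affinely independent points. A circumcenter of $T$ is a point $M$ for which there is $R>0$ with $\|A_i-M\|=R$ for all $i$. The centroid of $T$ (or of a face of $T$) is the arithmetic mean of its vertices. $\langle XY\rangle$ is the line through distinct points $X,Y$ and $[XY]$ is the closed segment. If $M\neq G$, the Euler line associated to $M$ is $\langle MG\rangle$. A point $X$ divides the segment $[AB]$ internally in the ratio $p:q$ ($p,q\ge 0$, $p+q>0$) if $X=A+\frac{p}{p+q}(B-A)$ (the ratio is measured starting from the first-named endpoint $A$). Monge point: for each ridge ($(d-2)$-face) $F$ of $T$ with opposite edge $E_F$ (the segment joining the two vertices not in $F$), if $M$ is not the midpoint of $E_F$, the associated Monge line is the line through the centroid of $F$ parallel to the line through $M$ and the midpoint of $E_F$. The Monge lines have exactly one common point, called the Monge point $N_M$. Complementary point: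 for $j=0,\dots,d$ let $G_j$ be the centroid of the facet opposite $A_j$; the complementary line of this facet with respect to $M$ is $\{A_j+t(G_j-M): t\in\mathbb{R}\}$. The common point of these $d+1$ complementary lines is called the complementary point $P_M$. *)

(* Defs.v *)
From mathcomp Require Import all_boot all_order all_algebra.
From mathcomp Require Import boolp classical_sets reals.

Set Implicit Arguments.
Unset Strict Implicit.
Unset Printing Implicit Defensive.

Import Order.TTheory GRing.Theory Num.Theory.
Local Open Scope classical_set_scope.
Local Open Scope ring_scope.

(* R^d is 'rV[R]_d. The norm of a Minkowski space is an arbitrary function
   satisfying [is_norm]; it is unrelated to the sup norm that the libraries
   attach to matrices. Nonnegativity follows from the three axioms. *)
Definition is_norm (R : realType) (d : nat) (nrm : 'rV[R]_d -> R) : Prop :=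
  [/\ forall x y, nrm (x + y) <= nrm x + nrm y,
      forall (a : R) x, nrm (a *: x) = `|a| * nrm x
    & forall x, nrm x = 0 -> x = 0].

(* A d-simplex is given by its family A of d+1 vertices, and a face of it by
   the set F of indices of the vertices of that face. *)
Definition affinely_independent (R : realType) (d : nat)
    (A : 'I_d.+1 -> 'rV[R]_d) : Prop :=
  forall c : 'I_d.+1 -> R,
    \sum_i c i = 0 -> \sum_i c i *: A i = 0 -> forall i, c i = 0.

Definition circumcenter (R : realType) (d : nat) (nrm : 'rV[R]_d -> R)
    (A : 'I_d.+1 -> 'rV[R]_d) (M : 'rV[R]_d) : Prop :=
  exists2 r : R, 0 < r & forall i, nrm (A i - M) = r.

Definition centroid (R : realType) (d : nat) (A : 'I_d.+1 -> 'rV[R]_d)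
    (F : {set 'I_d.+1}) : 'rV[R]_d :=
  (#|F|%:R)^-1 *: \sum_(i in F) A i.

(* Reduced to the point X when v = 0. *)
Definition line_dir (R : realType) (d : nat) (X v : 'rV[R]_d) :
    set 'rV[R]_d :=
  [set X + t *: v | t in [set: R]].

Definition line (R : realType) (d : nat) (X Y : 'rV[R]_d) : set 'rV[R]_d :=
  line_dir X (Y - X).

Definition divides_internally (R : realType) (d : nat)
    (X A B : 'rV[R]_d) (p q : R) : Prop :=
  [/\ 0 <= p, 0 <= q, 0 < p + q & X = A + (p / (p + q)) *: (B - A)].

(* The point X such that the intersection of the family is exactly {X}. The
   value 0 is a dummy, used only when the family has no common point or
   several ones. *)
Definition common_point (R : realType) (d : nat)
    (lines : set (set 'rV[R]_d)) : 'rV[R]_d :=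
  xget 0 [set X | \bigcap_(l in lines) l = [set X]].

(* A ridge F has d-1 vertices; its opposite edge has vertex set ~: F, so that
   the centroid of ~: F is the midpoint of that edge. *)
Definition monge_lines (R : realType) (d : nat) (A : 'I_d.+1 -> 'rV[R]_d)
    (M : 'rV[R]_d) : set (set 'rV[R]_d) :=
  [set line_dir (centroid A F) (centroid A (~: F) - M) |
    F in [set F : {set 'I_d.+1} |
           #|F| = (d - 1)%N /\ M <> centroid A (~: F)]].

Definition monge_point (R : realType) (d : nat) (A : 'I_d.+1 -> 'rV[R]_d)
    (M : 'rV[R]_d) : 'rV[R]_d :=
  common_point (monge_lines A M).

(* If M is the centroid of the facet opposite A j, the complementary line of
   that facet is the single point A j. *)
Definition complementary_lines (R : realType) (d : nat)
    (A : 'I_d.+1 -> 'rV[R]_d) (M : 'rV[R]_d) : set (set 'rV[R]_d) :=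
  [set line_dir (A j) (centroid A [set~ j]%SET - M) | j in [set: 'I_d.+1]].

Definition complementary_point (R : realType) (d : nat)
    (A : 'I_d.+1 -> 'rV[R]_d) (M : 'rV[R]_d) : 'rV[R]_d :=
  common_point (complementary_lines A M).

(* Main.v *)
Require Import Defs.
From mathcomp Require Import all_boot all_order all_algebra.
From mathcomp Require Import boolp classical_sets reals.
From mathcomp Require Import ring.

(** Let [m = d + 1 - k]. The whole simplex has centroid
    [G = (k C_F + m C_F') / (d + 1)] whenever [F] is a face with [k] vertices
    and [F'] is the opposite face, with centroids [C_F] and [C_F']. Hence

      [C_F + (m / k) (C_F' - M) = M + ((d + 1) / k) (G - M)],

    and the right-hand side depends on [F] only through [k]: the lines through
    [C_F] parallel to [M C_F'], for all faces [F] with [k] vertices, pass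
    through one point of the Euler line ([face_weights] and
    [face_line_euler_point] below). They cannot all coincide. If they did, with
    direction [u], then all differences [C_F' - M] would be multiples of [u],
    and exchanging one vertex of [F'] for another would make every edge of the
    simplex a multiple of [u] ([exchange_edge]), whereas two edges with a
    common vertex are independent ([edges_not_parallel]).

    The complementary lines are the case [k = 1] and the Monge lines the case
    [k = d - 1], so that [P = M + (d + 1) (G - M)] and
    [N = M + ((d + 1) / (d - 1)) (G - M)]; all four claims can be read off
    these two formulas. *)

Import Order.TTheory GRing.Theory Num.Theory.
Local Open Scope classical_set_scope.
Local Open Scope ring_scope.

Lemma common_point_eq (R : realType) (d : nat) (lines : set (set 'rV[R]_d))
    (Q : 'rV[R]_d) :
  \bigcap_(l in lines) l = [set Q] -> common_point lines = Q.
Proof.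
move=> linesQ; apply: xget_unique => // X /=.
by rewrite linesQ => QX; have : [set X] X by []; rewrite -QX.
Qed.

(** Two lines through [Q] meet only there unless they are parallel; the second
    hypothesis is the form of non-parallelism that also covers families with
    degenerate directions. *)
Lemma common_point_lines (R : realType) (d : nat) (I : Type) (D : set I)
    (X v : I -> 'rV[R]_d) (Q : 'rV[R]_d) :
    (forall i, D i -> line_dir (X i) (v i) Q) ->
    (forall u, ~ forall i, D i -> exists c, v i = c *: u) ->
  common_point [set line_dir (X i) (v i) | i in D] = Q.
Proof.
move=> lineQ not_par; apply: common_point_eq; apply/seteqP; split; last first.
  by move=> _ -> _ [i Di <-]; exact: lineQ.
move=> Y lineY; apply: contrapT => /= neYQ; apply: (not_par (Y - Q)) => i Di.
have [t _ defQ] := lineQ i Di.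
have [s _ defY] : line_dir (X i) (v i) Y by apply: lineY; exists i.
have defYQ : Y - Q = (s - t) *: v i.
  by rewrite -defY -defQ; apply/rowP => j; rewrite !mxE; ring.
exists (s - t)^-1; rewrite defYQ scalerA mulVf ?scale1r //.
apply: contra_notN neYQ => /eqP st0.
by apply/eqP; rewrite -subr_eq0 defYQ st0 scale0r.
Qed.

Lemma edges_independent (R : realType) (d : nat) (A : 'I_d.+1 -> 'rV[R]_d)
    (i j k : 'I_d.+1) (a b : R) :
    affinely_independent A -> i != j -> i != k -> j != k ->
    a *: (A j - A i) + b *: (A k - A i) = 0 ->
  a = 0 /\ b = 0.
Proof.
move=> hA ij ik jk rel.
pose e (l x : 'I_d.+1) : R := (x == l)%:R.
have sume l : \sum_x e l x = 1.
  rewrite (bigD1 l) //= /e eqxx big1 ?addr0 // => x /negPf ->; by [].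
have sumeA l : \sum_x e l x *: A x = A l.
  rewrite (bigD1 l) //= /e eqxx scale1r big1 ?addr0 // => x /negPf ->.
  by rewrite scale0r.
pose c x := a * e j x + b * e k x - (a + b) * e i x.
have c0 : forall x, c x = 0.
  apply: hA.
    by rewrite sumrB big_split /= -!mulr_sumr !sume; ring.
  under eq_bigr => x _ do rewrite /c scalerBl scalerDl -!scalerA.
  rewrite sumrB big_split /= -!scaler_sumr !sumeA -rel.
  by apply/rowP => l; rewrite !mxE; ring.
split.
  move: (c0 j); rewrite /c /e eqxx (negPf jk) [j == i]eq_sym (negPf ij).
  by rewrite !mulr0 mulr1 subr0 addr0.
move: (c0 k); rewrite /c /e eqxx ![k == _]eq_sym (negPf jk) (negPf ik).
by rewrite !mulr0 mulr1 subr0 add0r.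
Qed.

Lemma edges_not_parallel (R : realType) (d : nat) (A : 'I_d.+1 -> 'rV[R]_d)
    (u : 'rV[R]_d) :
    (2 <= d)%N -> affinely_independent A ->
  ~ forall i j, i != j -> exists c, A j - A i = c *: u.
Proof.
case: d A u => [|[|d]] // A u _ hA par.
pose i : 'I_d.+3 := Ordinal (isT : (0 < d.+3)%N).
pose j : 'I_d.+3 := Ordinal (isT : (1 < d.+3)%N).
pose k : 'I_d.+3 := Ordinal (isT : (2 < d.+3)%N).
have [a defa] := par i j isT; have [b defb] := par i k isT.
(* The edges a u and b u satisfy b (a u) - a (b u) = 0, so a = 0. *)
have [_ /eqP] : b = 0 /\ - a = 0.
  apply: (@edges_independent R d.+2 A i j k) => //.
  by rewrite defa defb !scalerA mulrC -scalerDl mulNr subrr scale0r.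
rewrite oppr_eq0 => /eqP a0.
(* The edge a u is then zero, which is again a nontrivial relation. *)
have [/eqP] : (1 : R) = 0 /\ (0 : R) = 0.
  apply: (@edges_independent R d.+2 A i j k) => //.
  by rewrite defa a0 !scale0r scaler0 addr0.
by rewrite oner_eq0.
Qed.

Lemma scale_card_centroid (R : realType) (d : nat) (A : 'I_d.+1 -> 'rV[R]_d)
    (F : {set 'I_d.+1}) : #|F|%:R *: centroid A F = \sum_(i in F) A i.
Proof.
have [F0|F0] := eqVneq #|F| 0%N.
  by rewrite F0 scale0r (cards0_eq F0) big_set0.
by rewrite /centroid scalerA mulfV ?scale1r // pnatr_eq0.
Qed.

Lemma face_weights (R : realType) (d : nat) (A : 'I_d.+1 -> 'rV[R]_d)
    (F : {set 'I_d.+1}) :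
  #|F|%:R *: centroid A F + #|~: F|%:R *: centroid A (~: F)
  = d.+1%:R *: centroid A [set: 'I_d.+1]%SET.
Proof.
have -> : d.+1%:R = #|[set: 'I_d.+1]%SET|%:R :> R by rewrite cardsT card_ord.
rewrite !scale_card_centroid (bigID (mem F) (mem [set: _]%SET)) /=.
by congr (_ + _); apply: eq_bigl => i; rewrite !inE.
Qed.

(** Exchanging one vertex of a face moves its centroid along an edge, so
    every edge is a difference of centroids of two faces with [m] vertices. *)
Lemma exchange_edge (R : realType) (d : nat) (A : 'I_d.+1 -> 'rV[R]_d)
    (m : nat) (i j : 'I_d.+1) :
    (0 < m <= d)%N -> i != j ->
  exists E E' : {set 'I_d.+1}, [/\ #|E| = m, #|E'| = m
    & A j - A i = m%:R *: (centroid A E' - centroid A E)].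
Proof.
case: m => // m /= md ij.
have cardC : #|(~: [set i; j])%SET| = d.-1.
  by have := cardsC [set i; j]%SET; rewrite cards2 ij card_ord => -[/(congr1 predn)].
have : (0 < #|[set B : {set 'I_d.+1} |
               (B \subset ~: [set i; j]) & (#|B| == m)]%SET|)%N.
  rewrite cards_draws cardC bin_gt0 -ltnS prednK //.
  exact: leq_trans md.
case/card_gt0P => B; rewrite inE => /andP[/fintype.subsetP sB /eqP cardB].
have iB : i \notin B by apply/negP => /sB; rewrite !inE eqxx.
have jB : j \notin B by apply/negP => /sB; rewrite !inE eqxx orbT.
have cE : #|(i |: B)%SET| = m.+1 by rewrite cardsU1 iB cardB.
have cE' : #|(j |: B)%SET| = m.+1 by rewrite cardsU1 jB cardB.
exists (i |: B)%SET, (j |: B)%SET; split=> //.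
rewrite scalerBr -{1}cE' -cE !scale_card_centroid !big_setU1 //=.
by rewrite opprD addrACA subrr addr0.
Qed.

(** The point of the Euler line common to the lines of all faces with [k]
    vertices. *)
Definition euler_point (R : realType) (d : nat) (A : 'I_d.+1 -> 'rV[R]_d)
    (M : 'rV[R]_d) (k : nat) : 'rV[R]_d :=
  M + (d.+1%:R / k%:R) *: (centroid A [set: 'I_d.+1]%SET - M).
Arguments euler_point {R d} A M k.

Lemma face_line_euler_point (R : realType) (d : nat)
    (A : 'I_d.+1 -> 'rV[R]_d) (M : 'rV[R]_d) (F : {set 'I_d.+1}) :
    (0 < #|F|)%N ->
  line_dir (centroid A F) (centroid A (~: F) - M) (euler_point A M #|F|).
Proof.
move=> F_gt0; exists (#|~: F|%:R / #|F|%:R) => //.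
have k0 : #|F|%:R != 0 :> R by rewrite pnatr_eq0 -lt0n.
have sumk : d.+1%:R = #|F|%:R + #|~: F|%:R :> R.
  by rewrite -natrD cardsC card_ord.
rewrite /euler_point !scalerBr [d.+1%:R / _]mulrC.
rewrite -[_ *: centroid A [set: _]%SET]scalerA -(face_weights R d A F) sumk.
move: (centroid A F) (centroid A (~: F)) => C C'.
by apply/rowP => l; rewrite !mxE; field.
Qed.

(** The set [D] may omit faces whose opposite face has centroid [M]: their
    direction is zero, which is a multiple of every vector, so they would not
    help to show that two lines differ. *)
Lemma common_point_face_lines (R : realType) (d : nat)
    (A : 'I_d.+1 -> 'rV[R]_d) (M : 'rV[R]_d) (k : nat)
    (D : set {set 'I_d.+1}) :
    (2 <= d)%N -> affinely_independent A -> (0 < k <= d)%N ->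
    (forall F, D F -> #|F| = k) ->
    (forall F : {set 'I_d.+1}, #|F| = k -> M <> centroid A (~: F) -> D F) ->
  common_point
    [set line_dir (centroid A F) (centroid A (~: F) - M) | F in D]
  = euler_point A M k.
Proof.
move=> d2 hA /andP[k0 kd] Dk kD; apply: common_point_lines => [F DF|u par].
  by rewrite -(Dk F DF); apply: face_line_euler_point; rewrite Dk.
have parE (E : {set 'I_d.+1}) :
    #|E| = (d.+1 - k)%N -> exists c, centroid A E - M = c *: u.
  move=> cardE.
  have cardCE : #|(~: E)%SET| = k.
    apply: (@addnI #|E|); rewrite cardsC card_ord cardE subnK //.
    exact: leqW.
  have [->|/eqP ME] := eqVneq M (centroid A E).
    by exists 0; rewrite subrr scale0r.
  rewrite -[E]finset.setCK; apply: par; apply: kD => //.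
  by rewrite finset.setCK => EM; apply: ME.
apply: (@edges_not_parallel R d A u d2 hA) => i j ij.
have [|E [E' [cE cE' ->]]] := @exchange_edge R d A (d.+1 - k) i j _ ij.
  by rewrite subn_gt0 ltnS kd leq_subLR -addn1 addnC leq_add2r.
have [c defc] := parE E cE; have [c' defc'] := parE E' cE'.
exists ((d.+1 - k)%:R * (c' - c)); rewrite -scalerA scalerBl -defc -defc'.
by rewrite opprB addrA subrK.
Qed.

Lemma complementary_pointE (R : realType) (d : nat)
    (A : 'I_d.+1 -> 'rV[R]_d) (M : 'rV[R]_d) :
    (2 <= d)%N -> affinely_independent A ->
  complementary_point A M = euler_point A M 1.
Proof.
move=> d2 hA.
pose vertices := [set F : {set 'I_d.+1} | #|F| = 1%N].
rewrite -(@common_point_face_lines R d A M 1 vertices) //; last first.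
  exact: ltnW.
congr common_point; apply/seteqP.
have centroid1 j : centroid A [set j]%SET = A j.
  by rewrite /centroid cards1 big_set1 invr1 scale1r.
split=> [_ [j _ <-]|_ [F /eqP/cards1P[j ->] <-]].
  by exists [set j]%SET; rewrite /vertices /= ?cards1 // centroid1.
by exists j; rewrite //= centroid1.
Qed.

Lemma monge_pointE (R : realType) (d : nat)
    (A : 'I_d.+1 -> 'rV[R]_d) (M : 'rV[R]_d) :
    (2 <= d)%N -> affinely_independent A ->
  monge_point A M = euler_point A M (d - 1).
Proof.
move=> d2 hA; apply: common_point_face_lines => // [|F []] //.
by rewrite subn_gt0 d2 leq_subr.
Qed.

Theorem theorem4p2 (R : realType) (d : nat) (hd : (2 <= d)%N)
    (nrm : 'rV[R]_d -> R) (hnrm : is_norm nrm)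
    (A : 'I_d.+1 -> 'rV[R]_d) (hA : affinely_independent A)
    (M : 'rV[R]_d) (hM : circumcenter nrm A M)
    (hMG : M <> centroid A [set: 'I_d.+1]%SET) :
  let G := centroid A [set: 'I_d.+1]%SET in
  let P := complementary_point A M in
  let N := monge_point A M in
  [/\ line M G P /\ line M G N,
      divides_internally G M P 1 d%:R,
      divides_internally N M P 1 (d%:R - 2)
    & divides_internally G M N (d%:R - 1) 2].
Proof.
move=> G P N; rewrite {}/P {}/N complementary_pointE // monge_pointE //.
rewrite /euler_point -/G natrB 1?ltnW //; clearbody G.
have d2 : 2 <= d%:R :> R by rewrite ler_nat.
have d0 : 0 <= d%:R :> R by rewrite ler0n.
have d1_gt0 : 0 < d%:R - 1 :> R by rewrite subr_gt0 ltr1n.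
have d1 : d%:R - 1 != 0 :> R by rewrite gt_eqF.
have dS : 1 + d%:R != 0 :> R by rewrite gt_eqF // ltr_pwDl.
have d12 : 1 + (d%:R - 2) = d%:R - 1 :> R by ring.
have d1S : d%:R - 1 + 2 = 1 + d%:R :> R by ring.
rewrite -[d.+1%:R]natr1; split.
- by split; [exists ((d%:R + 1) / 1) | exists ((d%:R + 1) / (d%:R - 1))].
- split=> //; first by rewrite ltr_pwDl.
  by apply/rowP => i; rewrite !mxE; field.
- split=> //; rewrite ?subr_ge0 ?d12 //.
  by apply/rowP => i; rewrite !mxE; field.
- split; rewrite ?d1S //; [exact: ltW | by rewrite ltr_pwDl |].
  by apply/rowP => i; rewrite !mxE; field; rewrite d1 dS.
Qed.
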